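(* Suppose all uncertainty in an arbitrage-free economy is generated by a Borel right process $X$ that is recurrent under the physical measure $\mathbb{P}$, and suppose the Arrow–Debreu state prices $\mathscr{P}_t(x,dy)$ are generated by a transition independent pricing kernel, i.e. by $S_t=e^{-\lambda t}\pi(X_0)/\pi(X_t)$ for some strictly positive finite Borel function $\pi$ on $E$ and some real $\lambda$. Then there exists a unique solution to the problem of recovering, from the knowledge of the state prices $(\mathscr{P}_t(x,dy))_{t\ge0,x\in E}$, the physical transition probabilities of $X$ and the pricing kernel in transition independent form. That is, there is exactly one triple $((P_t)_{t\ge 0},\pi,\lambda)$ ($\pi$ being considered up to a positive multiplicative constant) such that $\lambda\in\mathbb{R}$, $\pi$ is a strictly positive finite Borel function on $E$, $(P_t)_{t\ge 0}$ is the transition function of $X$ as a recurrent Borel right process under the physical measure, and $$\mathscr{P}_t(x,dy)=e^{-\lambda t}\frac{\pi(x)}{\pi(y)}P_t(x,dy)\quad\text{for all }t\ge0,\ x\in E .$$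
   Context: $E$ is a Lusin space (homeomorphic to a Borel subset of a compact metric space) having at least two points, with Borel sigma-field $\mathscr{E}$; $\mathscr{E}^*$ is the sigma-field of universally measurable subsets of $E$. $X=(\Omega,\mathscr{F},(\mathscr{F}_t)_{t\ge0},(X_t)_{t\ge0},(\mathbb{P}_x)_{x\in E})$ is a conservative Borel right process: a time-homogeneous strong Markov process with values in $E$, with right-continuous paths, shift operators $\theta_t$ ($X_s\circ\theta_t=X_{s+t}$), Borel measurable transition function $P_t(x,B)=\mathbb{P}_x(X_t\in B)$, $\mathbb{P}_x(X_0=x)=1$, $\mathbb{P}_x(X_t\in E)=1$. $(\mathscr{F}_t)$ is the filtration generated by $X$, completed with the $\mathbb{P}_\mu$-null sets for all initial distributions $\mu$. The family $\mathbb{P}=(\mathbb{P}_x)$ is the physical measure. Absence of arbitrage is expressed by existence of a pricing kernel: a strictly positive semimartingale $S$ with $S_0=1$, $S_->0$, $S_{t+s}(\omega)=S_t(\omega)S_s(\theta_t\omega)$, and $\mathbb{E}^{\mathbb P}_x[S_t]<\infty$ for all $t>0$, $x\in E$. The Arrow–Debreu state prices are the measures $\mathscr{P}_t(x,B)=\mathbb{E}^{\mathbb P}_x[S_t1_B(X_t)]$, $B\in\mathscr{E}$. The pricing kernel is transition independent if $S_t=e^{-\lambda t}\pi(X_0)/\pi(X_t)$ for some strictly positive finite Borel $\pi$ and real $\lambda$. Recurrence: with $R(x,B)=\int_0^\infty P_t(x,B)\,dt$, $X$ is recurrent if for each $B\in\mathscr{E}^*$ either $R(x,B)=0$ for all $x\in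 E$ or $R(x,B)=\infty$ for all $x\in E$. *)

(* Defs.v *)
From HB Require Import structures.
From mathcomp Require Import all_boot all_order all_algebra.
From mathcomp Require Import all_classical all_reals all_analysis.

Set Implicit Arguments.
Unset Strict Implicit.
Unset Printing Implicit Defensive.
Import Order.TTheory GRing.Theory Num.Theory.
Import numFieldNormedType.Exports.

Local Open Scope classical_set_scope.
Local Open Scope ring_scope.

(* Time is [0, +oo[, represented by R with explicit conditions 0 <= t; values
   of a process or of a transition function at negative times are irrelevant. *)

Notation borel E := (g_sigma_algebraType (@open E)).

Definition lusin_space (R : realType) (E : topologicalType) : Prop :=
  exists (K : metricType R) (f : E -> K),
    [/\ compact [set: K],
        <<s @open K >> (range f),
        injective f &
        forall U : set E, open U <-> exists2 V : set K, open V & U = f @^-1` V].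

(* The completion of a measure: the carrier is T with the sigma-algebra of the
   sets that are Caratheodory measurable for the outer measure m^*; for finite
   m this is the usual completed sigma-algebra. *)
Definition completion (R : realType) d (T : measurableType d)
  (m : {measure set T -> \bar R}) :
  {measure set (caratheodory_type (m^*)%mu) -> \bar R} :=
  @completed_measure_extension _ _ _ m.

Definition completed_sets (R : realType) d (T : measurableType d)
  (m : {measure set T -> \bar R}) : set_system T :=
  [set A | (m^*)%mu.-cara.-measurable A].

Definition universally_measurable (R : realType) d (T : measurableType d) :
  set_system T :=
  [set A | forall m : probability T R, completed_sets m A].

Section filtrations.
Context (R : realType) (E : ptopologicalType) d (Omega : measurableType d).
Implicit Types (X : R -> Omega -> E) (P : R.-pker (borel E) ~> Omega)
  (m : {measure set Omega -> \bar R}) (G : R -> set_system Omega)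
  (mu : probability (borel E) R).

Definition mixture mu P (A : set Omega) : \bar R := (\int[mu]_x P x A)%E.

Section mixture_measure.
Variables (mu : probability (borel E) R) (P : R.-pker (borel E) ~> Omega).

Let mixture0 : mixture mu P set0 = 0%E.
Proof. by rewrite /mixture; under eq_integral do rewrite measure0; rewrite integral0. Qed.

Let mixture_ge0 A : (0 <= mixture mu P A)%E.
Proof. exact: integral_ge0. Qed.

Let mixture_sigma_additive : semi_sigma_additive (mixture mu P).
Proof.
move=> U mU tU mUU; rewrite [X in _ --> X](_ : _ =
  \int[mu]_y (\sum_(n <oo) P y (U n))%E)%E; last first.
  apply: eq_integral => y _.
  by apply/esym/cvg_lim => //; exact/measure_semi_sigma_additive.
apply/cvg_closeP; split.
  by apply: is_cvg_nneseries => n _ _; exact: integral_ge0.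
rewrite closeE// integral_nneseries// => n.
exact: measurable_kernel.
Qed.

HB.instance Definition _ := isMeasure.Build _ _ _ (mixture mu P)
  mixture0 mixture_ge0 mixture_sigma_additive.

End mixture_measure.

Definition history X (I : set R) : set_system Omega :=
  <<s \bigcup_(s in I) preimage_set_system setT (X s : Omega -> borel E) measurable >>.

(* sigma(X_s, s <= t) enlarged by the null sets of the completion of m *)
Definition augmented_filtration X m (t : R) : set_system Omega :=
  [set A | exists2 B, history X `[0, t] B & m.-negligible (A `+` B)].

Definition natural_sigma_algebra X P : set_system Omega :=
  [set A | forall mu, completed_sets (mixture mu P) A].

Definition natural_filtration X P (t : R) : set_system Omega :=
  [set A | forall mu, augmented_filtration X (mixture mu P) t A].

Definition right_limit_filtration G (t : R) : set_system Omega :=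
  [set A | forall u, t < u -> G u A].

Definition stopping_time G (T : Omega -> \bar R) : Prop :=
  (forall w, 0 <= T w)%E /\
  forall t, 0 <= t -> G t [set w | (T w <= t%:E)%E].

Definition stopped_sigma_algebra (F : set_system Omega) G
    (T : Omega -> \bar R) : set_system Omega :=
  [set A | F A /\ forall t, 0 <= t -> G t (A `&` [set w | (T w <= t%:E)%E])].

(* The strong Markov property is required at the stopping times of the
   right-limit filtration (F_(t+)).  For right processes F_t = F_(t+), but this
   would not follow from the strong Markov property relative to (F_t) alone: a
   path leaving a point along one of two branches chosen at time 0+ satisfies
   the latter.  Deterministic T gives the simple Markov property. *)
Definition strong_markov X P (Q : R -> R.-pker (borel E) ~> (borel E)) : Prop :=
  forall (mu : probability (borel E) R) (T : Omega -> \bar R) (s : R)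
    (A : set Omega) (B : set E),
    let Fp := right_limit_filtration (natural_filtration X P) in
    stopping_time Fp T ->
    stopped_sigma_algebra (natural_sigma_algebra X P) Fp T A ->
    0 <= s ->
    measurable (B : set (borel E)) ->
    completion (mixture mu P)
      (A `&` [set w | (T w < +oo)%E] `&` [set w | B (X (fine (T w) + s) w)]) =
    (\int[completion (mixture mu P)]_(w in A `&` [set w | (T w < +oo)%E])
       Q s (X (fine (T w)) w) B)%E.

(* Conservativeness is built in: X t takes its values in E for all t >= 0,
   there is no cemetery, and every Q t x is a probability.  Omega carries the
   raw sigma-algebra sigma(X_t, t >= 0); its completions are derived from it. *)
Record borel_right_process X (theta : R -> Omega -> Omega) P
    (Q : R -> R.-pker (borel E) ~> (borel E)) : Prop := {
  brp_raw : (measurable : set_system Omega) = history X `[0, +oo[ ;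
  brp_rcont : forall w t, 0 <= t -> X s w @[s --> t^'+] --> X t w ;
  brp_shift : forall s t w, 0 <= s -> 0 <= t -> X s (theta t w) = X (s + t) w ;
  brp_start : forall x, P x [set w | X 0 w = x] = 1%E ;
  brp_transition : forall t x (B : set E), 0 <= t ->
    measurable (B : set (borel E)) -> Q t x B = P x (X t @^-1` B) ;
  brp_strong_markov : strong_markov X P Q
}.

End filtrations.

Definition potential (R : realType) (E : ptopologicalType)
    (Q : R -> R.-pker (borel E) ~> (borel E)) (x : E) (B : set E) : \bar R :=
  (\int[completed_lebesgue_measure]_(t in `[0%R, +oo[) completion (Q t x) B)%E.

Definition recurrent (R : realType) (E : ptopologicalType)
    (Q : R -> R.-pker (borel E) ~> (borel E)) : Prop :=
  forall B : set E, universally_measurable R (B : set (borel E)) ->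
    (forall x, potential Q x B = 0%E) \/ (forall x, potential Q x B = +oo%E).

Section semimartingales.
Context (R : realType) d (Omega : measurableType d).
Implicit Types (m : {measure set Omega -> \bar R}) (G : R -> set_system Omega)
  (M : R -> Omega -> R).

Definition adapted G M : Prop :=
  forall t (B : set R), 0 <= t -> measurable B -> G t (M t @^-1` B).

Definition cadlag (f : R -> R) : Prop :=
  (forall t, 0 <= t -> f s @[s --> t^'+] --> f t) /\
  (forall t, 0 < t -> cvg (f s @[s --> t^'-])).

Definition martingale m G M : Prop :=
  [/\ adapted G M,
      forall t, 0 <= t -> (completion m).-integrable setT (EFin \o M t) &
      forall s t A, 0 <= s -> s <= t -> G s A ->
        (\int[completion m]_(w in A) (M t w)%:E =
         \int[completion m]_(w in A) (M s w)%:E)%E].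

Definition stopped M (T : Omega -> \bar R) (t : R) (w : Omega) : R :=
  M (fine (Order.min t%:E (T w))) w.

Definition local_martingale0 m G M : Prop :=
  [/\ forall w, M 0 w = 0, forall w, cadlag (M ^~ w), adapted G M &
      exists T : nat -> Omega -> \bar R,
        [/\ forall n, stopping_time G (T n),
            {ae m, forall w, forall n, (T n w <= T n.+1 w)%E},
            {ae m, forall w, T n w @[n --> \oo] --> +oo%E} &
            forall n, martingale m G (stopped M (T n))]].

Definition finite_variation0 G M : Prop :=
  [/\ forall w, M 0 w = 0, forall w, cadlag (M ^~ w), adapted G M &
      forall w t, 0 <= t -> bounded_variation 0 t (M ^~ w)].

Definition semimartingale m G (S : R -> Omega -> R) : Prop :=
  adapted G S /\
  exists M A, [/\ local_martingale0 m G M, finite_variation0 G A &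
    {ae m, forall w, forall t, 0 <= t -> S t w = S 0 w + M t w + A t w}].

End semimartingales.

Section pricing.
Context (R : realType) (E : ptopologicalType) d (Omega : measurableType d).
Variables (X : R -> Omega -> E) (theta : R -> Omega -> Omega).
Implicit Types (P : R.-pker (borel E) ~> Omega) (S : R -> Omega -> R)
  (Q : R -> R.-pker (borel E) ~> (borel E)).

Record pricing_kernel P S : Prop := {
  pk_init : forall w, S 0 w = 1 ;
  pk_pos : forall t w, 0 <= t -> 0 < S t w ;
  pk_pos_left : forall x, {ae P x, forall w, forall t, 0 < t ->
    exists2 l : R, 0 < l & S s w @[s --> t^'-] --> l} ;
  pk_mult : forall t s w, 0 <= t -> 0 <= s ->
    S (t + s) w = S t w * S s (theta t w) ;
  pk_semimartingale : forall x,
    semimartingale (P x) (augmented_filtration X (P x)) S ;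
  pk_integrable : forall t x, 0 < t ->
    (\int[completion (P x)]_w (S t w)%:E < +oo)%E
}.

Definition positive_borel (pi : E -> R) : Prop :=
  measurable_fun setT (pi : borel E -> R) /\ forall x, 0 < pi x.

Definition transition_independent S : Prop :=
  exists (lambda : R) (pi : E -> R), positive_borel pi /\
    forall t w, 0 <= t ->
      S t w = expR (- lambda * t) * (pi (X 0 w) / pi (X t w)).

Definition state_price P S (t : R) (x : E) (B : set E) : \bar R :=
  (\int[completion (P x)]_(w in X t @^-1` B) (S t w)%:E)%E.

(* Q is the transition function that X has as a recurrent Borel right process
   under some physical measure P', on the given path space. *)
Definition physical_transition_function Q : Prop :=
  exists2 P' : R.-pker (borel E) ~> Omega,
    borel_right_process X theta P' Q & recurrent Q.

Definition recovery_solution (AD : R -> E -> set E -> \bar R)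
    Q (pi : E -> R) (lambda : R) : Prop :=
  [/\ physical_transition_function Q, positive_borel pi &
      forall t x (B : set E), 0 <= t -> measurable (B : set (borel E)) ->
        AD t x B =
        (\int[Q t x]_(y in B) (expR (- lambda * t) * (pi x / pi y))%:E)%E].

End pricing.

(* Main.v *)
Require Import Defs.
From mathcomp Require Import all_boot all_order all_algebra.
From mathcomp Require Import all_classical all_reals all_analysis.
From mathcomp Require Import measurable_realfun ring lra.

Set Implicit Arguments.
Unset Strict Implicit.
Unset Printing Implicit Defensive.
Import Order.TTheory GRing.Theory Num.Theory.
Import numFieldNormedType.Exports.
Local Open Scope classical_set_scope.
Local Open Scope ring_scope.

(* If (Q', pi', lambda') also generates the state prices, then
   Q'_t(x, dy) = e^(gamma t) (h(y) / h(x)) P_t(x, dy) with h = pi' / pi and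
   gamma = lambda' - lambda, so that h is a positive eigenfunction,
   P_t h = e^(- gamma t) h, while 1 / h plays the same role for Q' with - gamma.
   Exchanging the roles of the two solutions, assume gamma >= 0; then
   g = min(h, c) is bounded and satisfies P_t g <= g.  The decrease of
   t |-> P_t g(x) being bounded, the set {P_n g <= g - delta} has finite
   potential, hence potential zero by recurrence.  Therefore every set with
   nonzero potential contains a point z with P_n g(z) = g(z) for all n >= 1, and
   this forces gamma = 0 and h constant. *)

Import HBNNSimple.

(** * Functional induction and equality of weighted measures *)

(** A nonnegative measurable function is an increasing limit of simple functions, and these are
    finite nonnegative combinations of indicators. The closure conditions follow that
    construction. *)
Lemma ge0_measurable_fun_ind d (T : measurableType d) (R : realType)
    (P : (T -> \bar R) -> Prop) :
  (forall A, measurable A -> P (EFin \o \1_A)) ->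
  (forall (k : R) (f : T -> \bar R), 0 <= k -> measurable_fun setT f ->
     (forall x, 0 <= f x)%E -> P f -> P (fun x => k%:E * f x)%E) ->
  (forall f g : T -> \bar R, measurable_fun setT f -> measurable_fun setT g ->
     (forall x, 0 <= f x)%E -> (forall x, 0 <= g x)%E ->
     P f -> P g -> P (fun x => f x + g x)%E) ->
  (forall (f : (T -> \bar R)^nat) (g : T -> \bar R),
     (forall n, measurable_fun setT (f n)) ->
     (forall n x, 0 <= f n x)%E ->
     (forall x, nondecreasing_seq (f ^~ x)) ->
     (forall x, f n x @[n --> \oo] --> g x) ->
     (forall n, P (f n)) -> P g) ->
  forall f, measurable_fun setT f -> (forall x, 0 <= f x)%E -> P f.
Proof.
move=> Pind Pscale Padd Plim f mf f0.
pose f_ := nnsfun_approx measurableT mf.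
apply: (Plim (fun n => EFin \o f_ n)).
- by move=> n; exact/measurable_EFinP.
- by move=> n x; rewrite lee_fin.
- by move=> x a b ab; rewrite lee_fin; exact/lefP/nd_nnsfun_approx.
- by move=> x; exact: cvg_nnsfun_approx.
move=> n; set g := f_ n.
have -> : EFin \o g = (fun x =>
    \sum_(r <- finmap.enum_fset (fset_set (range g))) (r%:E * (\1_(g @^-1` [set r]) x)%:E))%E.
  apply/funext => x /=.
  rewrite fimfunE fsbig_finite//= -sumEFin.
  by apply: eq_bigr => r _; rewrite EFinM.
have : forall r, r \in finmap.enum_fset (fset_set (range g)) -> 0 <= r.
  by move=> r; rewrite in_fset_set// inE => -[x _ <-].
(* Induction on the list of levels: all that is kept about [range g] is that the levels are
   nonnegative. *)
elim: (finmap.enum_fset _) => [|r s ih] rs.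
  under eq_fun do rewrite big_nil.
  have -> : (fun=> 0%E) = EFin \o (\1_(@set0 T) : T -> R).
    by apply/funext => x /=; rewrite indic0.
  exact: Pind.
under eq_fun do rewrite big_cons.
have s0 x (t : R) : t \in s -> (0 <= t%:E * (\1_(g @^-1` [set t]) x)%:E)%E.
  by move=> ts; rewrite mule_ge0 // lee_fin // rs// inE ts orbT.
have r0 : 0 <= r by rewrite rs// inE eqxx.
have mi (t : R) : measurable_fun setT (fun x => (\1_(g @^-1` [set t]) x)%:E).
  exact/measurable_EFinP.
apply: Padd.
- exact: measurable_funeM.
- by apply: emeasurable_sum => t; exact: measurable_funeM.
- by move=> x; rewrite mule_ge0 // lee_fin.
- by move=> x; rewrite big_seq; apply: sume_ge0 => t; exact: s0.
- by apply: Pscale => //; exact: Pind.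
- by apply: ih => t ts; rewrite rs// inE ts orbT.
Qed.

(** Two weighted measures that agree on sets integrate every nonnegative function alike. The weights
    stay inside the integrals, so that no density measure has to be built. *)
Lemma eq_integral_density d (T : measurableType d) (R : realType)
    (m1 m2 : {measure set T -> \bar R}) (w1 w2 : T -> R) :
  measurable_fun setT w1 -> measurable_fun setT w2 ->
  (forall x, 0 <= w1 x) -> (forall x, 0 <= w2 x) ->
  (forall B, measurable B ->
     \int[m1]_(x in B) (w1 x)%:E = \int[m2]_(x in B) (w2 x)%:E)%E ->
  forall f : T -> \bar R, measurable_fun setT f -> (forall x, 0 <= f x)%E ->
    (\int[m1]_x (f x * (w1 x)%:E) = \int[m2]_x (f x * (w2 x)%:E))%E.
Proof.
move=> mw1 mw2 w10 w20 w12.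
have mM (f : T -> \bar R) (w : T -> R) : measurable_fun setT f ->
    measurable_fun setT w -> measurable_fun setT (fun x => f x * (w x)%:E)%E.
  by move=> mf mw; apply: emeasurable_funM => //; exact/measurable_EFinP.
have M0 (f : T -> \bar R) (w : T -> R) : (forall x, 0 <= f x)%E ->
    (forall x, 0 <= w x) -> forall x, (0 <= f x * (w x)%:E)%E.
  by move=> f0 w0 x; rewrite mule_ge0 ?lee_fin.
apply: (@ge0_measurable_fun_ind _ T R
  (fun f => \int[m1]_x (f x * (w1 x)%:E) = \int[m2]_x (f x * (w2 x)%:E)))%E.
- move=> A mA.
  have E (m : {measure set T -> \bar R}) (w : T -> R) :
      (\int[m]_x ((EFin \o \1_A) x * (w x)%:E) = \int[m]_(x in A) (w x)%:E)%E.
    rewrite [RHS]integral_mkcond; apply: eq_integral => x _ /=.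
    by rewrite epatch_indic/= muleC.
  by rewrite !E w12.
- move=> k f k0 mf f0 IH.
  under eq_integral do rewrite -muleA.
  under [RHS]eq_integral do rewrite -muleA.
  rewrite !ge0_integralZl_EFin ?IH// => *; solve [exact: M0|exact: mM].
- move=> f g mf mg f0 g0 If Ig.
  under eq_integral do rewrite ge0_muleDl//.
  under [RHS]eq_integral do rewrite ge0_muleDl//.
  rewrite !ge0_integralD ?If ?Ig // => *; solve [exact: M0|exact: mM].
- move=> f g mf f0 ndf fg IH.
  have E (m : {measure set T -> \bar R}) (w : T -> R) :
      measurable_fun setT w -> (forall x, 0 <= w x) ->
      (\int[m]_x (g x * (w x)%:E) = limn (fun n => \int[m]_x (f n x * (w x)%:E)))%E.
    move=> mw w0; rewrite -monotone_convergence//.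
    + by apply: eq_integral => x _; apply/esym/cvg_lim => //; exact: cvgeZr.
    + by move=> n; exact: mM.
    + by move=> n x _; exact: M0.
    + by move=> x _ a b ab; rewrite lee_wpmul2r ?lee_fin//; exact: ndf.
  rewrite !E//; under eq_fun do rewrite IH.
  by [].
Qed.

(** * Completions and images of measures *)

Lemma completionE d (T : measurableType d) (R : realType)
    (m : {measure set T -> \bar R}) (A : set T) :
  measurable A -> completion m A = m A.
Proof. exact: measurable_mu_extE. Qed.

Lemma completed_sets_measurable d (T : measurableType d) (R : realType)
    (m : {measure set T -> \bar R}) (A : set T) :
  measurable A -> completed_sets m A.
Proof. exact: caratheodory_measurable_mu_ext. Qed.

Lemma universally_measurable_measurable (R : realType) d
    (T : measurableType d) (A : set T) :
  measurable A -> universally_measurable R A.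
Proof. by move=> mA m; exact: completed_sets_measurable. Qed.

(** Change of variables for a measure [m2] that only agrees with the pushforward on measurable sets,
    as completions and the laws [Q t x] do. *)
Lemma ge0_integral_image d1 d2 (T1 : measurableType d1)
    (T2 : measurableType d2) (R : realType) (phi : T1 -> T2)
    (m1 : {measure set T1 -> \bar R}) (m2 : {measure set T2 -> \bar R})
    (D : set T2) (f : T2 -> \bar R) :
  measurable_fun setT phi ->
  (forall B, measurable B -> m2 B = m1 (phi @^-1` B)) ->
  measurable D -> measurable_fun D f -> (forall x, D x -> 0 <= f x)%E ->
  (\int[m2]_(y in D) f y = \int[m1]_(x in phi @^-1` D) f (phi x))%E.
Proof.
move=> mphi m12 mD mf f0.
pose pm : {measure set T2 -> \bar R} :=
  measure_function_pushforward__canonical__measure_function_Measure m1 mphi.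
rewrite (eq_measure_integral pm); last by move=> A mA _; exact: m12.
by rewrite (ge0_integral_pushforward mphi)// => x; rewrite inE; exact: f0.
Qed.

(** The identity map [j] from the completed space to the original one is measurable and carries
    [completion m] to [m]. *)
Lemma ge0_integral_completion d (T : measurableType d) (R : realType)
    (m : {measure set T -> \bar R}) (D : set T) (f : T -> \bar R) :
  measurable D -> measurable_fun D f -> (forall x, D x -> 0 <= f x)%E ->
  (\int[completion m]_(x in D) f x = \int[m]_(x in D) f x)%E.
Proof.
move=> mD mf f0.
pose j : caratheodory_type (m^*)%mu -> T := fun x => x.
have mj : measurable_fun setT j.
  by move=> _ A mA; rewrite setTI; exact: completed_sets_measurable.
rewrite (ge0_integral_image (m1 := completion m) mj)//.
by move=> B mB; rewrite -[LHS]completionE.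
Qed.

Lemma ge0_integral_completed_lebesgue (R : realType) (D : set R) (f : R -> \bar R) :
  measurable D -> measurable_fun D f -> (forall x, D x -> 0 <= f x)%E ->
  (\int[completed_lebesgue_measure]_(x in D) f x =
   \int[lebesgue_measure]_(x in D) f x)%E.
Proof.
move=> mD mf f0.
pose j : caratheodory_type ((@wlength R idfun)^*)%mu -> measurableTypeR R := fun x => x.
have mj : measurable_fun setT j.
  by move=> _ A mA; rewrite setTI; exact: (sub_caratheodory (wlength idfun)).
by rewrite (ge0_integral_image (m1 := completed_lebesgue_measure) mj).
Qed.

(** * Potentials of kernels measurable in time *)

Section potential_of_measurable_semigroup.
Context {R : realType} {E : ptopologicalType}.
Variable Q : R -> R.-pker (borel E) ~> (borel E).
Hypothesis mQ : forall x (B : set (borel E)), measurable B ->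
  measurable_fun (`[0, +oo[ : set R) (fun t => Q t x B).

Lemma potentialE x (B : set (borel E)) : measurable B ->
  (potential Q x B = \int[lebesgue_measure]_(t in `[0%R, +oo[) Q t x B)%E.
Proof.
move=> mB; rewrite -ge0_integral_completed_lebesgue//; last exact: mQ.
by apply: eq_integral => t _; rewrite completionE.
Qed.

(** A zero integral would make [Q t x B] vanish for almost all times, whereas the half-line is not
    Lebesgue-null. *)
Lemma potential_neq0 x (B : set (borel E)) : measurable B ->
  (forall t, 0 <= t -> (0 < Q t x B)%E) -> potential Q x B <> 0%E.
Proof.
move=> mB B0; rewrite potentialE//.
under eq_integral do rewrite -[Q _ _ _]gee0_abs//.
have m0 : measurable (`[0, +oo[ : set (measurableTypeR R)) by [].
move/(ae_eq_integral_abs lebesgue_measure m0 (mQ x mB)).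
case=> // N [mN N0 subN].
have : (lebesgue_measure (`[0%R, +oo[ : set R) <= lebesgue_measure N)%E.
  apply: le_measure; rewrite ?inE//.
  move=> t t0; apply: subN => /= /(_ t0).
  move: t0; rewrite /= in_itv/= andbT => /B0 /[swap] ->.
  by rewrite ltxx.
by rewrite N0 lebesgue_measure_itv/= ltry.
Qed.

Lemma potential_bigcup0 x (B : (set (borel E))^nat) :
  (forall n, measurable (B n)) -> (forall n, potential Q x (B n) = 0%E) ->
  potential Q x (\bigcup_n B n) = 0%E.
Proof.
move=> mB B0; have mUB : measurable (\bigcup_n B n) by exact: bigcup_measurable.
apply/eqP; rewrite eq_le; apply/andP; split; last first.
  by rewrite potentialE// integral_ge0.
have -> : 0%E = (\sum_(n <oo) potential Q x (B n))%E.
  by rewrite eseries0.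
rewrite potentialE//.
under eq_eseriesr do rewrite potentialE//.
rewrite -integral_nneseries//; last by move=> n; exact: mQ.
apply: ge0_le_integral => //.
- exact: mQ.
- by apply: ge0_emeasurable_sum => // n _; exact: mQ.
- by move=> t _; apply: measure_sigma_subadditive.
Qed.

(** Time is cut into slots of length [n]; the bound [a j] on slot [j] contributes [a j * n], so the
    potential is at most [C * n]. *)
Lemma potential_fin x (B : set (borel E)) (n : nat) (C : R) (a : nat -> R) :
  measurable B -> (0 < n)%N ->
  (forall j, 0 <= a j) -> (forall k, \sum_(j < k) a j <= C) ->
  (forall j t, (j * n)%:R <= t < (j.+1 * n)%:R -> (Q t x B <= (a j)%:E)%E) ->
  (potential Q x B < +oo)%E.
Proof.
move=> mB n0 a0 aC Ba.
pose I j : set R := `[(j * n)%:R, (j.+1 * n)%:R[%classic.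
have I0 : (`[0, +oo[ : set R) `<=` \bigcup_j I j.
  move=> t; rewrite /= in_itv/= andbT => t0.
  (* The slot containing [t] is the integer part of [t / n]. *)
  have n0' : 0 < n%:R :> R by rewrite ltr0n.
  exists (Num.truncn (t / n%:R)) => //; rewrite /I/= in_itv/= !natrM.
  have := Num.Theory.truncn_itv (divr_ge0 t0 (ltW n0')).
  by rewrite ler_pdivlMr// ltr_pdivrMr.
pose f j (t : R) : \bar R := ((a j)%:E * (\1_(I j) t)%:E)%E.
have f0 j t : (0 <= f j t)%E by rewrite mule_ge0 ?lee_fin.
have mI j : measurable_fun setT (fun t : R => (\1_(I j) t : R)%:E).
  by apply/measurable_EFinP; apply: measurable_indic; exact: measurable_itv.
have mf j : measurable_fun setT (f j) by exact: measurable_funeM.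
apply: (@le_lt_trans _ _ (C * n%:R)%:E); last exact: ltry.
rewrite potentialE//.
apply: (@le_trans _ _ (\int[lebesgue_measure]_t (\sum_(j <oo) f j t))%E).
  rewrite integral_mkcond; apply: ge0_le_integral => //.
  - by move=> t _; apply: erestrict_ge0.
  - by apply/(measurable_restrictT _ _).1 => //; exact: mQ.
  - by apply: ge0_emeasurable_sum => [j t _ _|j _]; [exact: f0|exact: mf].
  - move=> t _; rewrite patchE; case: ifPn => [|_]; last exact: nneseries_ge0.
    rewrite inE => /I0[j _ tj].
    apply: (@le_trans _ _ (f j t)).
      by rewrite /f indicE mem_set// mule1 Ba//; move: tj; rewrite /I/= in_itv.
    rewrite (@nneseriesD1 _ (f ^~ t) j xpredT)//.
    by rewrite leeDl// nneseries_ge0.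
rewrite integral_nneseries//.
have If j : (\int[lebesgue_measure]_t f j t = (a j * n%:R)%:E)%E.
  rewrite ge0_integralZl_EFin//; last exact: mI.
  rewrite integral_indic//=; last exact: measurable_itv.
  rewrite (_ : I j `&` _ = I j); last exact: setIT.
  rewrite lebesgue_measure_itv/= lte_fin ltr_nat ltn_mul2r n0 ltnSn/=.
  by rewrite -EFinB -EFinM mulSn natrD addrK.
under eq_eseriesr do rewrite If.
apply: lime_le.
  by apply: is_cvg_nneseries => j _ _; rewrite lee_fin mulr_ge0.
apply: nearW => k; rewrite sumEFin lee_fin -mulr_suml big_mkord.
by rewrite ler_wpM2r.
Qed.

End potential_of_measurable_semigroup.

(** * Borel structure of Lusin spaces *)

Section lusin.
Context {R : realType} {E : ptopologicalType}.
Hypothesis lusinE : lusin_space R E.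

Lemma lusin_measurable_set1 (x : E) : measurable ([set x] : set (borel E)).
Proof.
have [K [f [_ _ injf openE]]] := lusinE.
have -> : [set x] = ~` (f @^-1` (~` [set f x])).
  apply/seteqP; split => [y -> /=|y /=]; first by apply.
  by move=> /contrapT /injf.
apply: measurableC; apply: sub_sigma_algebra; apply/openE.
exists (~` [set f x]) => //; apply: closed_openC.
exact/accessible_closed_set1/hausdorff_accessible/metric_hausdorff.
Qed.

(** [F k] is the preimage of the interior of the points whose ball of radius 1/(k+1) stays in [V].
    Since closures remain in [U], membership of a limit in [U] can be read off from a sequence
    through countably many open sets. *)
Lemma lusin_open_exhaustion (U : set E) : open U ->
  exists F : (set E)^nat,
    [/\ forall k, open (F k), \bigcup_k F k = U & forall k, closure (F k) `<=` U].
Proof.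
have [K [f [_ _ injf openE]]] := lusinE.
move=> /openE[V oV UV].
pose W k : set K := [set z | ball z k.+1%:R^-1 `<=` V].
exists (fun k => f @^-1` (W k)°); split.
- by move=> k; apply/openE; exists (W k)° => //; exact: open_interior.
- rewrite UV; apply/seteqP; split => [x [k _ /= /interior_subset]|x /= Vfx].
    by apply; exact: ballxx.
  have /nbhs_ballP[e /= e0 eV] := open_nbhs_nbhs (conj oV Vfx).
  have [k ke] : exists k, k.+1%:R^-1 < e / 2.
    exists (Num.truncn (e / 2)^-1); rewrite -[ltRHS]invrK.
    rewrite ltf_pV2 ?posrE ?invr_gt0 ?divr_gt0//.
    exact: truncnS_gt.
  exists k => //=; apply/nbhs_ballP; exists (e / 2); first by rewrite /= divr_gt0.
  move=> z xz z' zz'; apply: eV; rewrite [e]splitr.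
  apply: ball_triangle xz _; exact: le_ball (ltW ke) _ zz'.
- move=> k x clx; rewrite UV /=.
  have : nbhs x (f @^-1` (ball (f x) k.+1%:R^-1)°).
    apply: open_nbhs_nbhs; split.
      by apply/openE; exists (ball (f x) k.+1%:R^-1)° => //; exact: open_interior.
    by apply: nbhsx_ballx.
  move=> /clx[y [/= /interior_subset Wy /interior_subset xy]].
  by apply: Wy; exact: ball_sym.
Qed.

End lusin.

(* Serves only to equip the measures [k x] with a [probability] structure. *)
Lemma prob_kernel_mnormalize d1 d2 (T1 : measurableType d1)
    (T2 : measurableType d2) (R : realType) (k : R.-pker T1 ~> T2) x :
  k x = mnormalize (k x) \d_point :> (set T2 -> \bar R).
Proof.
apply/funext => A; rewrite /mnormalize prob_kernel onee_eq0/=.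
by rewrite invr1 mule1.
Qed.

Lemma prob_kernel_fin_num d1 d2 (T1 : measurableType d1)
    (T2 : measurableType d2) (R : realType) (k : R.-pker T1 ~> T2) x A :
  measurable A -> k x A \is a fin_num.
Proof.
move=> mA; rewrite ge0_fin_numE//; apply: (@le_lt_trans _ _ (k x setT)).
  by apply: le_measure; rewrite ?inE.
by rewrite prob_kernel ltry.
Qed.

(** * Joint measurability and semigroup property of a Borel right process *)

Section borel_right_process_theory.
Context {R : realType} {E : ptopologicalType} {d : measure_display}
  {Omega : measurableType d}.
Hypothesis lusinE : lusin_space R E.
Variables (X : R -> Omega -> E) (theta : R -> Omega -> Omega)
  (P : R.-pker (borel E) ~> Omega) (Q : R -> R.-pker (borel E) ~> (borel E)).
Hypothesis XPQ : borel_right_process X theta P Q.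

Lemma measurable_process t : 0 <= t ->
  measurable_fun setT (X t : Omega -> borel E).
Proof.
move=> t0 _ B mB; rewrite setTI.
have -> : measurable = history X `[0, +oo[ := brp_raw XPQ.
apply: sub_sigma_algebra; exists t.
  by rewrite /= in_itv/= t0.
by exists B => //; rewrite setTI.
Qed.

Lemma ge0_integral_transition t x (B : set (borel E)) (f : E -> \bar R) :
  0 <= t -> measurable B -> measurable_fun B (f : borel E -> \bar R) ->
  (forall y, B y -> 0 <= f y)%E ->
  (\int[Q t x]_(y in B) f y = \int[P x]_(w in X t @^-1` B) f (X t w))%E.
Proof.
move=> t0 mB mf f0.
rewrite (ge0_integral_image (m1 := P x) (measurable_process t0))// => A mA.
exact: (brp_transition XPQ).
Qed.

Lemma mixture_dirac x (A : set Omega) : measurable A ->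
  mixture (\d_x : probability (borel E) R) P A = P x A.
Proof.
move=> mA; rewrite /mixture integral_dirac//; first by rewrite diracT mul1e.
exact: measurable_kernel.
Qed.

(** A constant event is the preimage under [X 0] of the empty set or of the whole space. This makes
    deterministic times stopping times. *)
Lemma right_limit_filtration_cst t (A : Prop) : 0 <= t ->
  right_limit_filtration (natural_filtration X P) t [set _ | A].
Proof.
move=> t0 u tu mu; exists [set _ | A]; last first.
  by rewrite setYK; exact: negligible_set0.
apply: sub_sigma_algebra; exists 0.
  by rewrite /= in_itv/= lexx (le_trans t0)// ltW.
exists [set _ | A]; last by rewrite setTI.
have [HA|HA] := pselect A.
  by rewrite (_ : mkset _ = setT)//; apply/seteqP; split.
by rewrite (_ : mkset _ = set0)//; apply/seteqP; split.
Qed.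

Lemma process_start_ae x : {ae P x, forall w, X 0 w = x}.
Proof.
pose A : set Omega := [set w | X 0 w = x].
have mA : measurable A.
  have := measurable_process (lexx 0) measurableT (lusin_measurable_set1 lusinE x).
  by rewrite setTI.
have PA : P x (~` A) = 0%E.
  transitivity (1 - P x A)%E; last by rewrite (brp_start XPQ) subee.
  by rewrite prob_kernel_mnormalize; exact: probability_setC.
exists (~` A); split=> //; exact: measurableC.
Qed.

Lemma chapman_kolmogorov s t x (B : set (borel E)) : 0 <= s -> 0 <= t ->
  measurable B -> Q (s + t) x B = (\int[Q s x]_y Q t y B)%E.
Proof.
move=> s0 t0 mB.
have mQtB : measurable_fun setT (fun y : borel E => Q t y B).
  exact: measurable_kernel.
rewrite (ge0_integral_transition _ s0)//= preimage_setT.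
rewrite (brp_transition XPQ)// ?addr_ge0//.
have mXst : measurable (X (s + t) @^-1` B).
  by rewrite -[X in measurable X]setTI; apply: measurable_process; rewrite ?addr_ge0.
have mXs : measurable_fun setT (fun w => Q t (X s w) B).
  by apply: (measurableT_comp mQtB); exact: measurable_process.
(* The strong Markov property at the constant time [s], started from [x]. *)
have := @brp_strong_markov _ _ _ _ _ _ _ _ XPQ (\d_x : probability (borel E) R)
  (fun=> s%:E) t setT B.
rewrite /= (_ : setT `&` _ = setT); last first.
  by apply/seteqP; split => // w _; split => //=; exact: ltry.
rewrite setTI => h; rewrite -mixture_dirac// -[LHS]completionE//.
rewrite [LHS]h {h}//; first last.
- split; first by move=> mu; exact: completed_sets_measurable.
  by move=> u u0; rewrite setTI; exact: right_limit_filtration_cst.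
- split => [w|u u0]; first by rewrite lee_fin.
  exact: right_limit_filtration_cst.
rewrite ge0_integral_completion//.
by apply: eq_measure_integral => A mA _; exact: mixture_dirac.
Qed.

(** Joint measurability in time and path is what makes [Q t x B] measurable in [t]. The maximum with
    0 is there because paths are unconstrained at negative times. *)
Lemma measurable_process_pair :
  measurable_fun setT (fun z : R * Omega => X (Num.max 0 z.1) z.2 : borel E).
Proof.
apply: (@measurability _ _ _ (borel E) setT _ (@open E)) => // _ [U oU <-].
rewrite setTI.
have [F [oF FU clF]] := lusin_open_exhaustion lusinE oU.
(* By right-continuity the path at time [t] is the limit of its values at the
   grid points [g n t], which decrease strictly to [t]. *)
pose m (n : nat) (t : R) := Num.truncn (Num.max 0 t * n.+1%:R).
pose g (n : nat) (t : R) : R := (m n t).+1%:R / n.+1%:R.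
have max0 (t : R) : 0 <= Num.max 0 t by rewrite le_max lexx.
have g_gt n t : Num.max 0 t < g n t.
  by rewrite /g ltr_pdivlMr//; exact: truncnS_gt.
have g_le n t : g n t <= Num.max 0 t + n.+1%:R^-1.
  rewrite /g -natr1 mulrDl mul1r lerD2r ler_pdivrMr//.
  by have /andP[] := Num.Theory.truncn_itv (mulr_ge0 (max0 t) (ler0n R n.+1)).
have g_cvg t : g n t @[n --> \oo] --> (Num.max 0 t)^'+.
  have gp : g n t @[n --> \oo] --> Num.max 0 t.
    apply: (@squeeze_cvgr _ _ _ _ (fun=> Num.max 0 t)
      (fun n => Num.max 0 t + n.+1%:R^-1)); last 2 first.
    - exact: cvg_cst.
    - rewrite -[X in _ --> X]addr0; apply: cvgD; first exact: cvg_cst.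
      exact: cvg_harmonic.
    by apply: nearW => n; rewrite g_le ltW.
  move=> A /gp[N _ NA]; exists N => // n Nn; apply: NA (g_gt n t); exact: Nn.
have Xg_cvg w t : X (g n t) w @[n --> \oo] --> X (Num.max 0 t) w.
  by move=> A /(brp_rcont XPQ (max0 t)) /(g_cvg t).
(* The limit lies in [U] exactly when, for some [k], the grid values eventually lie in [F k]:
   openness of [F k] gives one direction, its closure being inside [U] the other. *)
have -> : (fun z : R * Omega => X (Num.max 0 z.1) z.2) @^-1` U =
  \bigcup_k \bigcup_N \bigcap_(n in [set n | (N <= n)%N])
     [set z | F k (X (g n z.1) z.2)].
  apply/seteqP; split => [[t w] /=|[t w] /= [k _ [N _ NF]]].
    rewrite -FU => -[k _ Fk]; exists k => //.
    have /(_ (F k)) := Xg_cvg w t.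
    move=> /(_ (open_nbhs_nbhs (conj (oF k) Fk)))[N _ NF].
    by exists N => // n /= Nn; exact: NF.
  apply: (clF k) => A /(Xg_cvg w t)[N' _ N'A].
  exists (X (g (maxn N N') t) w); split.
    by apply: NF; rewrite /= leq_maxl.
  by apply: N'A; rewrite /= leq_maxr.
apply: bigcup_measurable => k _; apply: bigcup_measurable => N _.
apply: bigcap_measurable => [|n _]; first by exists N => /=.
(* For fixed [n] the grid time takes countably many values, hence a countable union of measurable
   rectangles. *)
have -> : [set z | F k (X (g n z.1) z.2)] =
  \bigcup_j ([set t | m n t = j] `*` (X (j.+1%:R / n.+1%:R) @^-1` F k)).
  apply/seteqP; split => [[t w] /= Fk|[t w] [j _ [/= <-]]//].
  by exists (m n t).
apply: bigcup_measurable => j _; apply: measurableX.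
  have mh : measurable_fun setT (fun t : R => Num.max 0 t * n.+1%:R).
    by apply: measurable_funM => //; exact: measurable_maxr.
  have := mh measurableT `[j%:R, j.+1%:R[%classic (measurable_itv _).
  rewrite setTI; congr measurable.
  apply/seteqP; split => t /=; rewrite in_itv/= /m.
    by rewrite -truncn_eq ?mulr_ge0// => /eqP.
  by move=> /eqP; rewrite truncn_eq ?mulr_ge0.
rewrite -[X in measurable X]setTI; apply: measurable_process; rewrite ?divr_ge0//.
exact: sub_sigma_algebra.
Qed.

(** [Q t x B] is the [P x]-measure of the section at [t] of a measurable subset of the product of
    time and path space. *)
Lemma measurable_transition_time x (B : set (borel E)) : measurable B ->
  measurable_fun (`[0, +oo[ : set R) (fun t => Q t x B).
Proof.
move=> mB.
pose A := [set z : R * Omega | B (X (Num.max 0 z.1) z.2)].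
have mA : measurable A.
  by have := measurable_process_pair measurableT mB; rewrite setTI.
have := measurable_fun_xsection (mnormalize (P x) \d_point) mA.
move/(measurable_funTS (D := (`[0, +oo[ : set R))).
apply: eq_measurable_fun => t; rewrite inE/= in_itv/= andbT => t0.
rewrite (brp_transition XPQ)// -prob_kernel_mnormalize; congr (P x _).
by rewrite /A; apply/seteqP; split => w; rewrite /xsection/= inE/= (max_idPr t0).
Qed.

End borel_right_process_theory.

(** * Bounded supermedian functions of a recurrent semigroup *)

Lemma ge0_integral_gap d (T : measurableType d) (R : realType)
    (m : {measure set T -> \bar R}) (f g : T -> \bar R) (k : R) (B : set T) :
  measurable_fun setT f -> measurable_fun setT g ->
  (forall x, 0 <= f x)%E -> 0 <= k -> measurable B ->
  (forall x, f x <= g x)%E -> (forall x, B x -> f x + k%:E <= g x)%E ->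
  (\int[m]_x f x + k%:E * m B <= \int[m]_x g x)%E.
Proof.
move=> mf mg f0 k0 mB fg Bfg.
have mi : measurable_fun setT (fun x => (\1_B x)%:E : \bar R).
  exact/measurable_EFinP.
have i0 x : (0 <= k%:E * (\1_B x)%:E :> \bar R)%E by rewrite mule_ge0 ?lee_fin.
have -> : (m B = \int[m]_x (\1_B x)%:E)%E by rewrite integral_indic// setIT.
rewrite -ge0_integralZl_EFin//.
rewrite -ge0_integralD//; [|exact: measurable_funeM].
apply: ge0_le_integral => //.
- by move=> x _; rewrite adde_ge0.
- by apply: emeasurable_funD => //; exact: measurable_funeM.
- move=> x _; rewrite indicE; case: (boolP (x \in B)) => xB.
    by rewrite mule1; apply: Bfg; rewrite -inE.
  by rewrite mule0 adde0.
Qed.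

Section recurrent_semigroup.
Context {R : realType} {E : ptopologicalType}.
Variable Q : R -> R.-pker (borel E) ~> (borel E).
Hypothesis mQ : forall x (B : set (borel E)), measurable B ->
  measurable_fun (`[0, +oo[ : set R) (fun t => Q t x B).
Hypothesis CK : forall s t x (B : set (borel E)), 0 <= s -> 0 <= t ->
  measurable B -> Q (s + t) x B = (\int[Q s x]_y Q t y B)%E.
Hypothesis Qrec : recurrent Q.

(** A finite value at a single point excludes the infinite alternative of the recurrence
    dichotomy. *)
Lemma potential_recurrent (B : set (borel E)) x : measurable B ->
  (potential Q x B < +oo)%E -> forall y, potential Q y B = 0%E.
Proof.
move=> mB QB.
have [//|/(_ x) Qoo] := Qrec (@universally_measurable_measurable R _ _ _ mB).
by move: QB; rewrite Qoo ltxx.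
Qed.

(** Functional induction carries the Chapman-Kolmogorov equation from sets to nonnegative
    functions. *)
Lemma integral_semigroup s t x (f : borel E -> \bar R) : 0 <= s -> 0 <= t ->
  measurable_fun setT f -> (forall y, 0 <= f y)%E ->
  (\int[Q (s + t) x]_y f y = \int[Q s x]_y \int[Q t y]_z f z)%E.
Proof.
move=> s0 t0 mf f0.
have mQf (h : borel E -> \bar R) : measurable_fun setT h ->
    (forall y, 0 <= h y)%E ->
    measurable_fun setT (fun y => \int[Q t y]_z h z)%E.
  move=> mh h0; apply: measurable_fun_integral_kernel => // U mU.
  exact: measurable_kernel.
have Qf0 (h : borel E -> \bar R) y : (forall y, 0 <= h y)%E ->
    (0 <= \int[Q t y]_z h z)%E.
  by move=> h0; exact: integral_ge0.
apply: (@ge0_measurable_fun_ind _ _ R (fun f =>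
  \int[Q (s + t) x]_y f y = \int[Q s x]_y \int[Q t y]_z f z)%E) => // {mf f0 f}.
- move=> A mA; rewrite integral_indic//= setIT CK//.
  by apply: eq_integral => y _; rewrite integral_indic// setIT.
- move=> k f k0 mf f0 IH; rewrite ge0_integralZl_EFin// IH.
  rewrite -ge0_integralZl_EFin//; last 2 first.
  + by move=> y _; exact: Qf0.
  + exact: mQf.
  by apply: eq_integral => y _; rewrite ge0_integralZl_EFin.
- move=> f g mf mg f0 g0 If Ig; rewrite ge0_integralD// If Ig.
  rewrite -ge0_integralD//; last 4 first.
  + by move=> y _; exact: Qf0.
  + exact: mQf.
  + by move=> y _; exact: Qf0.
  + exact: mQf.
  by apply: eq_integral => y _; rewrite ge0_integralD.
- move=> f g mf f0 ndf fg IH.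
  have lim_int (m : {measure set (borel E) -> \bar R}) :
      (\int[m]_y g y = limn (fun n => \int[m]_y f n y))%E.
    rewrite -monotone_convergence//.
    by apply: eq_integral => y _; apply/esym/cvg_lim => //; exact: fg.
  rewrite lim_int; under eq_fun do rewrite IH.
  rewrite -monotone_convergence//.
  + by apply: eq_integral => y _; rewrite -lim_int.
  + by move=> n; exact: mQf.
  + by move=> n y _; exact: Qf0.
  + move=> y _ a b ab; apply: ge0_le_integral => // z _; exact: ndf.
Qed.

Section bounded_supermedian.
Variables (g : borel E -> R) (c : R).
Hypotheses (mg : measurable_fun setT g) (g0 : forall y, 0 <= g y)
  (gc : forall y, g y <= c).
Hypothesis Qg : forall t x, 0 <= t -> (\int[Q t x]_y (g y)%:E <= (g x)%:E)%E.

Let F t x := (\int[Q t x]_y (g y)%:E)%E.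

Let mg' : measurable_fun setT (EFin \o g).
Proof. exact/measurable_EFinP. Qed.

Let F0 t x : (0 <= F t x)%E.
Proof. by apply: integral_ge0 => y _; rewrite lee_fin. Qed.

Let Ffin t x : 0 <= t -> F t x \is a fin_num.
Proof.
move=> t0; rewrite ge0_fin_numE//.
by apply: le_lt_trans (Qg x t0) _; exact: ltry.
Qed.

Let mF t : measurable_fun setT (F t).
Proof.
apply: measurable_fun_integral_kernel => // U mU; exact: measurable_kernel.
Qed.

Lemma supermedian_antitone s t x : 0 <= s -> s <= t -> (F t x <= F s x)%E.
Proof.
move=> s0 st; rewrite -(subrKC s t) /F integral_semigroup ?subr_ge0//.
apply: ge0_le_integral => //.
- by move=> y _; exact: F0.
- exact: mF.
- by move=> y _; apply: Qg; rewrite subr_ge0.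
Qed.

(* Every visit to [B] costs [F . x] a decrease of [k] over the next [n] units
   of time, and [F . x] is bounded. *)
Lemma supermedian_drop (B : set (borel E)) (n : nat) (k : R) :
  measurable B -> (0 < n)%N -> 0 < k ->
  (forall y, B y -> F n%:R y + k%:E <= (g y)%:E)%E ->
  forall x, potential Q x B = 0%E.
Proof.
move=> mB n0 k0 Bk x; apply: (@potential_recurrent _ x) => //.
pose a j := fine (F (j * n)%:R x).
have aE j : F (j * n)%:R x = (a j)%:E by rewrite fineK// Ffin.
have a0 j : 0 <= a j by rewrite -lee_fin -aE.
have ale j l : (j <= l)%N -> a l <= a j.
  move=> jl; rewrite -lee_fin -!aE; apply: supermedian_antitone => //.
  by rewrite ler_nat leq_mul2r jl orbT.
(* For [t] in slot [j], [F t x] is at most [a j], while [t + n] lies before the end of slot [j.+1],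
   so [F (t + n) x] is at least [a j.+2]. The differences [a j - a j.+2] telescope in two
   interleaved chains, whence the bound [a 0 + a 1]. *)
apply: (@potential_fin _ _ Q mQ x B n (k^-1 * (a 0%N + a 1%N))
  (fun j => k^-1 * (a j - a j.+2))) => //.
- by move=> j; rewrite mulr_ge0 ?invr_ge0 ?(ltW k0)// subr_ge0 ale// leqW.
- move=> N; rewrite -mulr_sumr ler_wpM2l ?invr_ge0 ?(ltW k0)//.
  have -> : \sum_(j < N) (a j - a j.+2) = a 0%N + a 1%N - (a N + a N.+1).
    elim: N => [|N IH]; first by rewrite big_ord0 subrr.
    by rewrite big_ord_recr/= IH; ring.
  by rewrite lerBlDr lerDl addr_ge0.
- move=> j t /andP[jt tj].
  have t0 : 0 <= t by exact: le_trans jt.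
  (* Integrate the assumed drop on [B], and the plain inequality elsewhere, against [Q t x]. *)
  have h : (F (t + n%:R) x + k%:E * Q t x B <= F t x)%E.
    rewrite {1}/F integral_semigroup//.
    apply: ge0_integral_gap => //.
    + exact: mF.
    + by move=> y; exact: F0.
    + exact: ltW.
    + by move=> y; exact: Qg.
  have h2 : ((a j.+2)%:E + k%:E * Q t x B <= (a j)%:E)%E.
    rewrite -!aE; apply: le_trans (le_trans h _); last exact: supermedian_antitone.
    apply: leeD => //; apply: supermedian_antitone; first by rewrite addr_ge0.
    by rewrite (mulSn j.+1) natrD addrC lerD2l ltW.
  move: h2; have := prob_kernel_fin_num (Q t) x mB.
  move=> /fineK <-; rewrite -EFinM -EFinD !lee_fin => h2.
  by rewrite ler_pdivlMl// lerBrDl.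
Qed.

(** Were there no such point, [B] would be the countable union of the sets [C n k] on which [g]
    drops by at least 1/(k+1) by time n+1. Each has potential zero, hence so would [B]. *)
Lemma supermedian_invariant_point (B : set (borel E)) (x : E) : measurable B ->
  potential Q x B <> 0%E ->
  exists2 z, B z & forall n : nat, F n.+1%:R z = (g z)%:E.
Proof.
move=> mB QB; apply: contrapT => noz; apply: QB.
pose C n k := B `&` [set y | F n.+1%:R y + k.+1%:R^-1%:E <= (g y)%:E]%E.
have mC n k : measurable (C n k).
  apply: measurableI => //.
  rewrite -[X in measurable X]setTI; apply: measurable_lee => //.
  by apply: emeasurable_funD => //; exact: mF.
have -> : B = \bigcup_n \bigcup_k C n k.
  apply/seteqP; split => [y By|y [n _ [k _ []//]]].
  apply: contrapT => yC; apply: noz; exists y => // n.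
  apply/eqP; rewrite eq_le Qg//=; apply: contrapT => /negP; rewrite -ltNge => lt.
  apply: yC; exists n => //.
  have Fn : F n.+1%:R y \is a fin_num by exact: Ffin.
  move: lt; rewrite -(fineK Fn) lte_fin -subr_gt0 => lt.
  (* Any [k] with 1/(k+1) below the positive drop will do. *)
  exists (Num.truncn (g y - fine (F n.+1%:R y))^-1) => //; split => //=.
  rewrite -(fineK Fn) -EFinD lee_fin addrC -lerBrDr.
  rewrite -[leRHS]invrK lef_pV2 ?posrE ?invr_gt0//.
  by apply: ltW; exact: truncnS_gt.
have mC' n : measurable (\bigcup_k C n k) by exact: bigcup_measurable.
apply: potential_bigcup0 => // n; apply: potential_bigcup0 => // k.
by apply: (@supermedian_drop _ n.+1 k.+1%:R^-1) => // y [].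
Qed.

End bounded_supermedian.

End recurrent_semigroup.

(** * Positive eigenfunctions of a recurrent semigroup *)

(** If the set were null, [g <= f] would hold almost everywhere and the integrals would compare the
    other way. *)
Lemma integral_lt_measure_gt0 d (T : measurableType d) (R : realType)
    (m : {measure set T -> \bar R}) (f g : T -> \bar R) :
  measurable_fun setT f -> measurable_fun setT g ->
  (forall x, 0 <= f x)%E -> (forall x, 0 <= g x)%E ->
  (\int[m]_x f x < \int[m]_x g x)%E -> (0 < m [set x | f x < g x]%E)%E.
Proof.
move=> mf mg f0 g0 fg; rewrite lt0e measure_ge0 andbT; apply/eqP => m0.
move: fg; apply/negP; rewrite -leNgt; apply: ae_ge0_le_integral => //.
exists [set x | f x < g x]%E; split => //.
  by rewrite -[X in measurable X]setTI; exact: measurable_lte.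
by move=> x /= /not_implyP[_ /negP]; rewrite -ltNge.
Qed.

Lemma recurrent_eigenfunction_constant (R : realType) (E : ptopologicalType)
    (Q : R -> R.-pker (borel E) ~> (borel E))
    (mQ : forall x (B : set (borel E)), measurable B ->
      measurable_fun (`[0, +oo[ : set R) (fun t => Q t x B))
    (CK : forall s t x (B : set (borel E)), 0 <= s -> 0 <= t ->
      measurable B -> Q (s + t) x B = (\int[Q s x]_y Q t y B)%E)
    (Qrec : recurrent Q) (h : borel E -> R) (gamma : R) :
  measurable_fun setT h -> (forall x, 0 < h x) -> 0 <= gamma ->
  (forall t x, 0 <= t ->
     (\int[Q t x]_y (h y)%:E = (expR (- gamma * t) * h x)%:E)%E) ->
  gamma = 0 /\ forall x y, h x = h y.
Proof.
move=> mh h0 gamma0 Qh.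
pose g c y := Num.min (h y) c.
have mh' : measurable_fun setT (EFin \o h) by exact/measurable_EFinP.
have mg c : measurable_fun setT (g c) by exact: measurable_minr.
have mg' c : measurable_fun setT (EFin \o g c) by exact/measurable_EFinP.
have g0 c y : 0 <= c -> 0 <= g c y by move=> c0; rewrite le_min c0 ltW.
have gc c y : g c y <= c by rewrite ge_min lexx orbT.
have gh c y : g c y <= h y by rewrite ge_min lexx.
have int_cst t x (c : R) : (\int[Q t x]_y c%:E = c%:E)%E.
  by rewrite integral_cst// prob_kernel mule1.
have Qgh c t x : 0 <= c -> 0 <= t ->
    (\int[Q t x]_y (g c y)%:E <= (expR (- gamma * t) * h x)%:E)%E.
  move=> c0 t0; rewrite -Qh//.
  apply: ge0_le_integral => // [y _||y _]; [|exact: mg'|];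
    by rewrite lee_fin ?g0.
have Qgc c t x : 0 <= c -> (\int[Q t x]_y (g c y)%:E <= c%:E)%E.
  move=> c0; rewrite -[leRHS](int_cst t x).
  apply: ge0_le_integral => // [y _||y _]; [|exact: mg'|];
    by rewrite lee_fin ?g0.
have Qg c : 0 <= c -> forall t x, 0 <= t ->
    (\int[Q t x]_y (g c y)%:E <= (g c x)%:E)%E.
  (* Both [h] and the constant [c] are supermedian, the former because [gamma] is nonnegative, and a
     minimum inherits this. *)
  move=> c0 t x t0; rewrite EFin_min le_min Qgc// andbT.
  apply: (le_trans (Qgh _ _ _ c0 t0)); rewrite lee_fin.
  apply: ler_piMl; first exact: ltW.
  by rewrite -expR0 ler_expR mulNr oppr_le0 mulr_ge0.
have invariant_point c (B : set (borel E)) (x : E) :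
    0 <= c -> measurable B -> potential Q x B <> 0%E ->
    exists2 z, B z & forall n : nat,
      (\int[Q n.+1%:R z]_y (g c y)%:E = (g c z)%:E)%E.
  move=> c0; apply: supermedian_invariant_point => //.
  - by move=> y; exact: g0.
  - exact: Qg.
have potT x : potential Q x setT <> 0%E.
  by apply: potential_neq0 => // t _; rewrite prob_kernel lte01.
(* Otherwise an invariant point of [min(h, 1)] would have
   [min(h, 1) <= exp(- gamma n) h -> 0]. *)
have gamma_eq0 : gamma = 0.
  apply/eqP; rewrite eq_le gamma0 andbT leNgt; apply/negP => gamma_gt0.
  have [z _ Fz] := invariant_point 1 setT point ler01 measurableT (potT _).
  have gz0 : 0 < g 1 z by rewrite lt_min h0 ltr01.
  (* Chosen so that [h z < g 1 z * gamma * n.+1]. As exp(u) >= 1 + u, this contradicts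
     [g 1 z <= exp(- gamma * n.+1) * h z]. *)
  pose n := Num.truncn (h z / (g 1 z * gamma)).
  have hn : h z < g 1 z * gamma * n.+1%:R.
    by rewrite mulrC -ltr_pdivrMr ?mulr_gt0//; exact: truncnS_gt.
  have := Qgh 1 n.+1%:R z ler01 (ler0n _ _).
  rewrite Fz lee_fin mulNr expRN ler_pdivlMl ?expR_gt0// leNgt => /negP; apply.
  apply: (lt_le_trans hn); rewrite -mulrA [leLHS]mulrC.
  apply: ler_wpM2r; first exact: ltW.
  by apply: le_trans (expR_ge1Dx (gamma * n.+1%:R)); rewrite lerDr.
split => //; rewrite {}gamma_eq0 in Qh.
have {}Qh t x : 0 <= t -> (\int[Q t x]_y (h y)%:E = (h x)%:E)%E.
  by move=> /Qh ->; rewrite oppr0 mul0r expR0 mul1r.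
suff le x y : h x <= h y by move=> x y; apply/eqP; rewrite eq_le !le.
rewrite leNgt; apply/negP => yx.
pose c := (h x + h y) / 2; pose e := (c + h y) / 2.
have hyc : h y < c by rewrite /c; lra.
have ec : e < c by rewrite /e; lra.
have hye : h y < e by rewrite /e; lra.
have cx : c < h x by rewrite /c; lra.
have y0 := h0 y.
have c0 : 0 <= c by lra.
have e0 : 0 <= e by lra.
have mgt : measurable [set z | c%:E < (h z)%:E]%E.
  by rewrite -[X in measurable X]setTI; exact: measurable_lte.
have mlt : measurable [set z | (h z)%:E < e%:E]%E.
  by rewrite -[X in measurable X]setTI; exact: measurable_lte.
(* Now that [h] is invariant, its mean under [Q t x] is [h x > c], so every [Q t x] charges
   [{c < h}]. Symmetrically, every [Q t y] charges [{h < e}]. *)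
have potgt : potential Q x [set z | c%:E < (h z)%:E]%E <> 0%E.
  apply: potential_neq0 => // t t0.
  apply: integral_lt_measure_gt0 => //; first by move=> z; rewrite lee_fin ltW.
  by rewrite Qh// int_cst lte_fin.
have potlt : potential Q y [set z | (h z)%:E < e%:E]%E <> 0%E.
  apply: potential_neq0 => // t t0.
  apply: integral_lt_measure_gt0 => //; first by move=> z; rewrite lee_fin ltW.
  by rewrite Qh// int_cst lte_fin.
(* If [h y < e < c < h x], the set [{c < h}] is recurrent and so contains an
   invariant point [z] of [min(h, c)]; from [z] the process never visits
   [{h < e}], which is recurrent as well. *)
have [z /=] := invariant_point c _ x c0 mgt potgt.
rewrite lte_fin => cz Fz.
have gz : g c z = c by apply/min_idPr/ltW.
(* Invariance at integer times extends to all [t]: the value at [t] lies between the one at the next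
   integer, which is [c], and the upper bound [c]. *)
have Ft t : 0 <= t -> (\int[Q t z]_y (g c y)%:E = c%:E)%E.
  move=> t0; apply/eqP; rewrite eq_le Qgc//= -[X in (X%:E <= _)%E]gz.
  rewrite -(Fz (Num.truncn t)).
  apply: (supermedian_antitone CK (mg c) _ (Qg _ c0)) => //.
  - by move=> u; exact: g0.
  - by apply: ltW; exact: truncnS_gt.
(* [g c] falls short of [c] by at least [c - e] on [{h < e}], yet its mean is [c]. *)
have Qlt t : 0 <= t -> (Q t z [set u | (h u)%:E < e%:E] = 0)%E.
  move=> t0; apply/eqP; rewrite eq_le measure_ge0 andbT.
  have : (\int[Q t z]_u (g c u)%:E + (c - e)%:E * Q t z [set u | (h u)%:E < e%:E]
       <= \int[Q t z]_u c%:E)%E.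
    apply: ge0_integral_gap => //.
    - exact: mg'.
    - by move=> u; rewrite lee_fin g0.
    - by rewrite subr_ge0 ltW.
    - by move=> u; rewrite lee_fin.
    - move=> u /=; rewrite lte_fin => ue; rewrite -EFinD lee_fin.
      by have := gh c u; lra.
  rewrite Ft// int_cst -[leRHS]adde0 leeD2lE// => h1.
  by rewrite -(@pmule_rle0 _ (c - e)%:E) ?lte_fin ?subr_gt0.
have pot0 : potential Q z [set u | (h u)%:E < e%:E]%E = 0%E.
  rewrite potentialE//; apply: integral0_eq => t; rewrite /= in_itv/= andbT.
  exact: Qlt.
by apply: potlt; apply: (potential_recurrent Qrec (x := z)) => //; rewrite pot0.
Qed.

(** * Comparison of two solutions of the recovery problem *)

Lemma measurable_funV_gt0 d (T : measurableType d) (R : realType) (p : T -> R) :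
  (forall x, 0 < p x) -> measurable_fun setT p ->
  measurable_fun setT (fun x => (p x)^-1).
Proof.
move=> p0 mp.
have -> : (fun x => (p x)^-1) = (fun x => expR (- ln (p x))).
  by apply/funext => x; rewrite expRN lnK// posrE.
apply: measurableT_comp => //; apply: measurableT_comp => //.
exact: measurableT_comp.
Qed.

(** Testing the equality of the two weighted measures on [\1_B * pi1] cancels the weight of [m1]. *)
Lemma eq_integral_density_ratio d (T : measurableType d) (R : realType)
    (m1 m2 : {measure set T -> \bar R}) (pi1 pi2 : T -> R) (k1 k2 : R) :
  measurable_fun setT pi1 -> measurable_fun setT pi2 ->
  (forall y, 0 < pi1 y) -> (forall y, 0 < pi2 y) -> 0 < k1 -> 0 < k2 ->
  (forall B, measurable B -> \int[m1]_(y in B) (k1 / pi1 y)%:E =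
                             \int[m2]_(y in B) (k2 / pi2 y)%:E)%E ->
  forall B, measurable B ->
    (k1%:E * m1 B = k2%:E * \int[m2]_(y in B) (pi1 y / pi2 y)%:E)%E.
Proof.
move=> mpi1 mpi2 pi1_gt0 pi2_gt0 k1_gt0 k2_gt0 m12 B mB.
have mV (k : R) (p : T -> R) : (forall y, 0 < p y) -> measurable_fun setT p ->
    measurable_fun setT (fun y => k / p y).
  by move=> p0 mp; apply: measurable_funM => //; exact: measurable_funV_gt0.
have V0 (k : R) (p : T -> R) : (forall y, 0 < p y) -> 0 < k ->
    forall y, 0 <= k / p y.
  by move=> p0 k0 y; rewrite divr_ge0// ltW.
have mf : measurable_fun setT (fun y => (\1_B y * pi1 y)%:E : \bar R).
  by apply/measurable_EFinP; exact: measurable_funM.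
have f0 y : (0 <= (\1_B y * pi1 y)%:E :> \bar R)%E.
  by rewrite lee_fin mulr_ge0// ltW.
have := eq_integral_density (mV _ _ pi1_gt0 mpi1) (mV _ _ pi2_gt0 mpi2)
  (V0 _ _ pi1_gt0 k1_gt0) (V0 _ _ pi2_gt0 k2_gt0) m12 mf f0.
have -> : (\int[m1]_y ((\1_B y * pi1 y)%:E * (k1 / pi1 y)%:E) = k1%:E * m1 B)%E.
  have -> : (m1 B = \int[m1]_y (\1_B y)%:E)%E by rewrite integral_indic// setIT.
  rewrite -ge0_integralZl_EFin ?ltW//; last exact/measurable_EFinP.
  apply: eq_integral => y _; rewrite -!EFinM; congr EFin.
  by field; rewrite gt_eqF.
move=> ->.
rewrite [in RHS]integral_mkcond -ge0_integralZl_EFin ?ltW//; last 2 first.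
- by move=> y _; apply: erestrict_ge0 => z _; rewrite lee_fin divr_ge0 ?ltW.
- apply/(measurable_restrictT _ _).1 => //; apply: measurable_funTS.
  apply/measurable_EFinP; apply: measurable_funM => //.
  exact: measurable_funV_gt0.
apply: eq_integral => y _; rewrite epatch_indic/= -!EFinM; congr EFin; field.
by rewrite gt_eqF.
Qed.

Section recovery.
Context {R : realType} {E : ptopologicalType} {d : measure_display}
  {Omega : measurableType d}.
Hypothesis lusinE : lusin_space R E.
Variables (X : R -> Omega -> E) (theta : R -> Omega -> Omega).

(** This is the existence half: almost surely [X 0 = x], so [pi (X 0)] becomes [pi x], and the
    remaining integrand depends on [X t] alone, whose law is [Q t x]. *)
Lemma state_price_transition (P : R.-pker (borel E) ~> Omega)
    (Q : R -> R.-pker (borel E) ~> (borel E)) (S : R -> Omega -> R)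
    (pi : E -> R) (lambda : R) :
  borel_right_process X theta P Q -> positive_borel pi ->
  (forall t w, 0 <= t ->
     S t w = expR (- lambda * t) * (pi (X 0 w) / pi (X t w))) ->
  forall t x (B : set E), 0 <= t -> measurable (B : set (borel E)) ->
    state_price X P S t x B =
    (\int[Q t x]_(y in B) (expR (- lambda * t) * (pi x / pi y))%:E)%E.
Proof.
move=> XPQ [mpi pi0] SE t x B t0 mB.
have mX0 : measurable_fun setT (X 0 : Omega -> borel E).
  exact: (measurable_process XPQ).
have mXt : measurable_fun setT (X t : Omega -> borel E).
  exact: (measurable_process XPQ).
have mXtB : measurable (X t @^-1` B).
  by rewrite -[Y in measurable Y]setTI; exact: mXt.
have mV : measurable_fun setT (fun y : borel E => (pi y)^-1).
  exact: measurable_funV_gt0.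
rewrite (ge0_integral_transition XPQ)//; last 2 first.
- apply/measurable_EFinP; apply: measurable_funM => //.
  by apply: measurable_funM => //; exact: measurable_funTS.
- by move=> y _; rewrite lee_fin mulr_ge0 ?expR_ge0// divr_ge0// ltW.
have mS : measurable_fun setT (fun w => (S t w)%:E : \bar R).
  apply/measurable_EFinP; rewrite (_ : S t = fun w =>
    expR (- lambda * t) * (pi (X 0 w) * (pi (X t w))^-1)).
    apply: measurable_funM => //; apply: measurable_funM.
      exact: (measurableT_comp mpi mX0).
    exact: (measurableT_comp mV mXt).
  by apply/funext => w; rewrite SE.
rewrite /state_price ge0_integral_completion//; last 2 first.
- exact: measurable_funTS.
- by move=> w _; rewrite SE// lee_fin mulr_ge0 ?expR_ge0// divr_ge0// ltW.
apply: ae_eq_integral => //.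
- exact: measurable_funTS.
- apply: measurable_funTS; apply/measurable_EFinP; apply: measurable_funM => //.
  apply: measurable_funM => //.
  exact: (measurableT_comp mV mXt).
have := process_start_ae lusinE XPQ x; apply: filterS => w X0 _.
by rewrite SE// X0.
Qed.

Lemma recovery_density (AD : R -> E -> set E -> \bar R)
    (Q1 Q2 : R -> R.-pker (borel E) ~> (borel E)) (pi1 pi2 : E -> R)
    (lambda1 lambda2 : R) :
  recovery_solution X theta AD Q1 pi1 lambda1 ->
  recovery_solution X theta AD Q2 pi2 lambda2 ->
  forall t x (B : set (borel E)), 0 <= t -> measurable B ->
    ((expR (- lambda1 * t) * pi1 x)%:E * Q1 t x B =
     (expR (- lambda2 * t) * pi2 x)%:E * \int[Q2 t x]_(y in B) (pi1 y / pi2 y)%:E)%E.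
Proof.
move=> [_ [mpi1 pi1_gt0] AD1] [_ [mpi2 pi2_gt0] AD2] t x B t0.
apply: eq_integral_density_ratio => //.
- by rewrite mulr_gt0// expR_gt0.
- by rewrite mulr_gt0// expR_gt0.
- move=> A mA; under eq_integral do rewrite -mulrA.
  by under [RHS]eq_integral do rewrite -mulrA; rewrite -AD1// -AD2.
Qed.

(** For [B] the whole space, [Q1 t x B] is 1, and the density formula says that [pi1 / pi2] is an
    eigenfunction of [Q2] with rate [lambda1 - lambda2]. The order of the rates makes it
    nonnegative. *)
Lemma recovery_eigenfunction (AD : R -> E -> set E -> \bar R)
    (Q1 Q2 : R -> R.-pker (borel E) ~> (borel E)) (pi1 pi2 : E -> R)
    (lambda1 lambda2 : R) :
  recovery_solution X theta AD Q1 pi1 lambda1 ->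
  recovery_solution X theta AD Q2 pi2 lambda2 ->
  lambda2 <= lambda1 ->
  lambda1 = lambda2 /\ forall x y, pi1 x / pi2 x = pi1 y / pi2 y.
Proof.
move=> sol1 sol2 le12.
have rec_density := recovery_density sol1 sol2.
move: sol1 sol2 => [_ [mpi1 pi1_gt0] _] [[P2 XP2 rec2] [mpi2 pi2_gt0] _].
have [||||/subr0_eq -> //] := recurrent_eigenfunction_constant
  (measurable_transition_time lusinE XP2) (chapman_kolmogorov XP2) rec2
  (h := fun x => pi1 x / pi2 x) (gamma := lambda1 - lambda2).
- by apply: measurable_funM => //; exact: measurable_funV_gt0.
- by move=> x; rewrite divr_gt0.
- by rewrite subr_ge0.
- move=> t x t0; have := rec_density t x setT t0 measurableT.
  rewrite prob_kernel mule1.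
  have k_gt0 : 0 < expR (- lambda2 * t) * pi2 x by rewrite mulr_gt0// expR_gt0.
  set k := expR (- lambda2 * t) * pi2 x in k_gt0 *.
  set I := (\int[_]_(_ in _) _)%E => kI.
  have -> : I = (k^-1%:E * (k%:E * I))%E.
    by rewrite muleA -EFinM mulVf ?gt_eqF// mul1e.
  rewrite -kI -EFinM /k; congr EFin.
  have -> : - (lambda1 - lambda2) * t = - lambda1 * t - - lambda2 * t by ring.
  rewrite expRD expRN; field.
  by rewrite !gt_eqF// expR_gt0.
Qed.

Lemma recovery_unique (AD : R -> E -> set E -> \bar R)
    (Q1 Q2 : R -> R.-pker (borel E) ~> (borel E)) (pi1 pi2 : E -> R)
    (lambda1 lambda2 : R) :
  recovery_solution X theta AD Q1 pi1 lambda1 ->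
  recovery_solution X theta AD Q2 pi2 lambda2 ->
  [/\ forall t x (B : set E), 0 <= t -> measurable (B : set (borel E)) ->
        Q1 t x B = Q2 t x B,
      exists2 c : R, 0 < c & forall x, pi1 x = c * pi2 x &
      lambda1 = lambda2].
Proof.
move=> sol1 sol2; have rec_density := recovery_density sol1 sol2.
have [_ [_ pi1_gt0] _] := sol1; have [_ [_ pi2_gt0] _] := sol2.
have {sol1 sol2}[lambda12 pi12] :
    lambda1 = lambda2 /\ forall x y, pi1 x / pi2 x = pi1 y / pi2 y.
  have [le12|/ltW le21] := leP lambda2 lambda1.
    exact: recovery_eigenfunction sol1 sol2 le12.
  (* In the other order the ratio [pi2 / pi1] is constant; invert it. *)
  have [-> pi21] := recovery_eigenfunction sol2 sol1 le21; split => // x y.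
  by rewrite -[LHS]invf_div (pi21 x y) invf_div.
pose c := pi1 point / pi2 point.
have c0 : 0 < c by rewrite divr_gt0.
have pi1E x : pi1 x = c * pi2 x.
  by rewrite /c -(pi12 x) divfK// gt_eqF.
split => //; last by exists c.
move=> t x B t0 mB; have := rec_density t x B t0 mB; rewrite lambda12.
(* With a constant ratio the density formula reduces to equality of [Q1] and [Q2], up to a common
   positive finite factor. *)
under eq_integral do rewrite -(pi12 point).
rewrite integral_cst// -/c muleA -EFinM -mulrA [pi2 x * c]mulrC -pi1E => eqk.
have k0 : 0 < expR (- lambda2 * t) * pi1 x by rewrite mulr_gt0// expR_gt0.
move: eqk; rewrite -(fineK (prob_kernel_fin_num (Q1 t) x mB)).
rewrite -(fineK (prob_kernel_fin_num (Q2 t) x mB)) -!EFinM => -[].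
by move=> /(mulfI (lt0r_neq0 k0)) ->.
Qed.

End recovery.

Theorem theorem3p3 (R : realType) (E : ptopologicalType)
  (lusinE : lusin_space R E) (two_points : exists x y : E, x <> y)
  (d : measure_display) (Omega : measurableType d)
  (X : R -> Omega -> E) (theta : R -> Omega -> Omega)
  (P : R.-pker (borel E) ~> Omega)
  (Pt : R -> R.-pker (borel E) ~> (borel E))
  (X_brp : borel_right_process X theta P Pt) (X_rec : recurrent Pt)
  (S : R -> Omega -> R) (S_pk : pricing_kernel X theta P S)
  (S_ti : transition_independent X S) :
  let AD := state_price X P S in
  exists (Q : R -> R.-pker (borel E) ~> (borel E)) (pi : E -> R) (lambda : R),
    recovery_solution X theta AD Q pi lambda /\
    forall (Q' : R -> R.-pker (borel E) ~> (borel E)) (pi' : E -> R)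
        (lambda' : R),
      recovery_solution X theta AD Q' pi' lambda' ->
      [/\ forall t x (B : set E), 0 <= t -> measurable (B : set (borel E)) ->
            Q' t x B = Q t x B,
          exists2 c : R, 0 < c & forall x, pi' x = c * pi x &
          lambda' = lambda].
Proof.
have [lambda [pi [pi_borel SE]]] := S_ti.
have ADE := state_price_transition lusinE X_brp pi_borel SE.
have phys : physical_transition_function X theta Pt by exists P.
(* Uniqueness uses nothing about the state prices beyond their representation, so they become an
   arbitrary family [AD]. *)
move: (state_price X P S) ADE => AD ADE /=.
have solPt : recovery_solution X theta AD Pt pi lambda by split.
exists Pt, pi, lambda; split => // Q' pi' lambda' sol'.
by have := recovery_unique lusinE sol' solPt.
Qed.
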